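(* Let $D$ be a finite oriented graph (with at least one vertex) with minimum out-degree $\delta^+(D)\le 4$. Then there is a vertex $x\in V(D)$ with $d^+_D(x)=\delta^+(D)$ such that $x$ is a strong Seymour vertex of $D$.
   Context: A digraph has no loops and no multiple arcs; $V(D)$ and $A(D)$ denote its vertex set and arc set. An oriented graph is a digraph without 2-cycles (i.e. $(u,v)$ and $(v,u)$ are never both arcs). For a vertex $v$, $N_D^+(v)=\{y:(v,y)\in A(D)\}$ is the set of out-neighbors, $d_D^+(v)=|N_D^+(v)|$ is the out-degree, and $\delta^+(D)$ is the minimum out-degree over all vertices. The second out-neighborhood of $v$ is $$N^{++}_D(v)=\{z\in V(D)\setminus (N_D^+(v)\cup\{v\}) : (v,y),(y,z)\in A(D)\text{ for some }y\in N_D^+(v)\}.$$ For disjoint vertex sets $X,Y$, a matching from $X$ to $Y$ is a set of arcs $(x_i,y_i)\in A(D)$ with $x_i\in X$, $y_i\in Y$, no two of which share an endpoint; it is a complete matching from $X$ to $Y$ if every vertex of $X$ is the tail of some arc of it (for $X=\emptyset$ the empty set is a complete matching). A vertex $x$ is a strong Seymour vertex of $D$ if there is a complete matching from $N^+_D(x)$ to $N^{++}_D(x)$. *)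

(* Defs.v *)
From mathcomp Require Import all_boot.

Set Implicit Arguments.
Unset Strict Implicit.
Unset Printing Implicit Defensive.

(* A finite digraph without multiple arcs is an arc relation on a finite type:
   [D u v] means that (u, v) is an arc, and the vertex set is the whole of T. *)

Definition oriented_graph (T : finType) (D : rel T) : Prop :=
  irreflexive D /\ (forall u v : T, ~ (D u v /\ D v u)).

Definition out_nbhd (T : finType) (D : rel T) (v : T) : {set T} :=
  [set y | D v y].

Definition out_degree (T : finType) (D : rel T) (v : T) : nat :=
  #|out_nbhd D v|.

(* Every out-degree is at most #|T|, so the initial value #|T| does not affect
   the minimum as soon as T is nonempty. *)
Definition min_out_degree (T : finType) (D : rel T) : nat :=
  \big[minn/#|T|]_(v : T) out_degree D v.

Definition second_out_nbhd (T : finType) (D : rel T) (v : T) : {set T} :=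
  [set z in ~: (out_nbhd D v :|: [set v]) |
    [exists y in out_nbhd D v, D v y && D y z]].

Definition matching (T : finType) (D : rel T) (X Y : {set T})
    (M : {set T * T}) : Prop :=
  (forall a, a \in M -> [/\ D a.1 a.2, a.1 \in X & a.2 \in Y]) /\
  (forall a b, a \in M -> b \in M -> a != b ->
     [disjoint [set a.1; a.2] & [set b.1; b.2]]).

Definition complete_matching (T : finType) (D : rel T) (X Y : {set T})
    (M : {set T * T}) : Prop :=
  matching D X Y M /\ (forall x, x \in X -> exists2 a, a \in M & a.1 = x).

Definition strong_seymour_vertex (T : finType) (D : rel T) (x : T) : Prop :=
  exists M : {set T * T},
    complete_matching D (out_nbhd D x) (second_out_nbhd D x) M.

(* Main.v *)
Require Import Defs.
From mathcomp Require Import all_boot.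
From mathcomp Require Import zify.

Set Implicit Arguments.
Unset Strict Implicit.
Unset Printing Implicit Defensive.

(* By Hall's theorem, a vertex [x] of minimum out-degree [d] that is not strong
   Seymour has a nonempty set [S] of out-neighbours and a set [B] smaller than
   [S] such that all arcs from [S] stay in [N(x) :|: B].  Put
   [C = (N(x) \ S) :|: B]; since [#|C| < d], every vertex of [S] has an
   out-neighbour in [S], and those with only one have out-degree [d] and
   dominate [C].  As [#|S| <= 4], counting arcs inside [S] gives an arc from
   [y] to [w] between two such vertices.  If [y] is not strong Seymour either,
   then, [w] being a source of [N(y) = w |: C], a second count forces arcs
   from all of [C] to an out-neighbour [z] of [w] in [S].  But then [N(z)] is
   contained in [S :\ z], which has fewer than [d] elements. *)

(** * Hall's marriage theorem *)

(** Induction on [#|X|]. A nonempty proper subset [S] with equality in Hall's condition splits the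
    problem into [S] and [X :\: S]. If there is none, every nonempty proper subset has a neighbour
    to spare, so one [x] can be matched arbitrarily and removed. *)
Lemma hall (T : finType) (e : T -> {set T}) (X : {set T}) :
  (forall S : {set T}, S \subset X -> #|S| <= #|\bigcup_(x in S) e x|) ->
  exists f : T -> T, {in X &, injective f} /\ {in X, forall x, f x \in e x}.
Proof.
have [n] := ubnP #|X|; elim: n e X => // n IHn e X leXn hallX.
have [->|[x Xx]] := set_0Vmem X.
  by exists id; split=> x; rewrite inE.
have glue (S : {set T}) (f g : T -> T) : S \subset X ->
    {in S &, injective f} -> {in S, forall y, f y \in e y} ->
    {in X :\: S &, injective g} ->
    {in X :\: S, forall y, g y \in e y :\: f @: S} ->
    exists h, {in X &, injective h} /\ {in X, forall y, h y \in e y}.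
  move=> sSX injf ef injg eg.
  exists (fun y => if y \in S then f y else g y); split=> [y z Xy Xz|y Xy].
    case: (boolP (y \in S)) (boolP (z \in S)) => Sy [] Sz.
    - exact: injf.
    - move=> Efg; have := eg z; rewrite !inE Sz Xz -Efg => /(_ isT).
      by rewrite imset_f.
    - move=> Efg; have := eg y; rewrite !inE Sy Xy Efg => /(_ isT).
      by rewrite imset_f.
    - by apply: injg; rewrite inE ?Sy ?Sz.
  case: ifPn => Sy; first exact: ef.
  by have := eg y; rewrite !inE Sy Xy => /(_ isT)/andP[].
have [/existsP[S /and4P[sSX S0 SX tight]]|/existsPn loose] :=
    boolP [exists S : {set T}, [&& S \subset X, S != set0, S != X
                                & #|\bigcup_(y in S) e y| <= #|S|]].
  have ltSX : #|S| < #|X| by rewrite proper_card // properEneq SX.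
  have S_gt0 : 0 < #|S| by rewrite card_gt0.
  have cardX : #|X| = #|S| + #|X :\: S| by rewrite -(cardsID S X) (setIidPr sSX).
  have [||f [injf ef]] := IHn e S; first by lia.
    by move=> W sWS; apply/hallX/(subset_trans sWS).
  have [||g [injg eg]] := IHn (fun y => e y :\: \bigcup_(z in S) e z) (X :\: S).
  - by lia.
  (* Hall's condition for [W :|: S], less the equality at [S], leaves enough neighbours of [W]
     outside those of [S]. *)
  - move=> W; rewrite subsetD => /andP[sWX dWS].
    have /hallX : W :|: S \subset X by rewrite subUset sWX.
    rewrite bigcup_setU cardsU (disjoint_setI0 dWS) cards0.
    have -> : \bigcup_(y in W) (e y :\: \bigcup_(z in S) e z)
        = \bigcup_(y in W) e y :\: \bigcup_(z in S) e z.
      apply/setP=> u; rewrite inE; apply/bigcupP/andP=> [[y Wy]|[Su]].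
        by rewrite inE => /andP[-> eu]; split=> //; apply/bigcupP; exists y.
      by case/bigcupP=> y Wy eu; exists y; rewrite // inE Su.
    rewrite cardsD cardsU.
    have := subset_leq_card (subsetIl (\bigcup_(y in W) e y)
                                      (\bigcup_(y in S) e y)).
    by lia.
  apply: (glue S f g) => // y Xy; have := eg y Xy; rewrite !inE => /andP[Sy ->].
  rewrite andbT; apply: contra Sy => /imsetP[z Sz ->].
  by apply/bigcupP; exists z; rewrite ?ef.
have [u eu] : exists u, u \in e x.
  apply/card_gt0P; have := hallX [set x].
  by rewrite sub1set Xx cards1 big_set1; apply.
have [||g [injg eg]] := IHn (fun y => e y :\ u) (X :\ x).
- by rewrite (cardsD1 x X) Xx in leXn.
- move=> W; rewrite subsetD1 => /andP[sWX Wx].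
  have -> : \bigcup_(y in W) (e y :\ u) = (\bigcup_(y in W) e y) :\ u.
    apply/setP=> v; rewrite in_setD1; apply/bigcupP/andP=> [[y Wy]|[vu]].
      by rewrite in_setD1 => /andP[-> ev]; split=> //; apply/bigcupP; exists y.
    by case/bigcupP=> y Wy ev; exists y; rewrite // in_setD1 vu.
  have [->|W0] := eqVneq W set0; first by rewrite cards0.
  have WX : W != X by apply: contraNneq Wx => ->.
  have := loose W; rewrite sWX W0 WX /= -ltnNge.
  rewrite [X in _ < X](cardsD1 u); lia.
apply: (glue [set x] (fun=> u) g); rewrite ?sub1set //.
- by move=> y z /set1P-> /set1P->.
- by move=> y /set1P->.
- move=> y /eg; rewrite !inE => /andP[yu ->]; rewrite andbT.
  by apply: contra yu => /imsetP[z _ ->].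
Qed.

(** * Obstructions to being a strong Seymour vertex *)

Section Oriented.

Variables (T : finType) (D : rel T).
Hypothesis D_oriented : oriented_graph D.

Local Notation N := (out_nbhd D).

Lemma arcC u v : D u v -> ~~ D v u.
Proof. by move=> Duv; apply/negP=> Dvu; case: D_oriented => _ /(_ u v); apply. Qed.

Lemma arcxx u : D u u = false.
Proof. by case: D_oriented => ->. Qed.

(** A Hall violator with its neighbourhood relaxed to any set [B]: the counting arguments need only
    the size of [B]. *)
Definition obstruction (x : T) (S B : {set T}) : Prop :=
  [/\ S \subset N x, S != set0, #|B| < #|S|
    & forall y, y \in S -> N y \subset N x :|: B].

Lemma strong_seymour_or_obstruction x :
  strong_seymour_vertex D x \/ exists S B, obstruction x S B.
Proof.
pose e y := N y :&: second_out_nbhd D x.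
have [/existsP[S /andP[sSx ltS]]|/existsPn hallx] :=
    boolP [exists S : {set T},
             (S \subset N x) && (#|\bigcup_(y in S) e y| < #|S|)].
  right; exists S, (\bigcup_(y in S) e y); split=> // [|y Sy].
    by rewrite -card_gt0; apply: leq_ltn_trans ltS.
  apply/subsetP=> z yz; rewrite inE; case: (boolP (z \in N x)) => //= xz.
  apply/bigcupP; exists y; rewrite // inE yz.
  have Dxy := subsetP sSx _ Sy; rewrite !inE in Dxy yz xz *.
  rewrite (negPf xz) /=; apply/andP; split.
    by apply: contraTneq yz => ->; apply: arcC.
  by apply/existsP; exists y; rewrite inE Dxy.
left; have [S sSx|f [injf ef]] := @hall _ e (N x).
  by have := hallx S; rewrite sSx -leqNgt.
exists [set (y, f y) | y in N x]; split; last first.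
  by move=> y xy; exists (y, f y) => //; apply/imsetP; exists y.
split=> [a /imsetP[y xy ->]|a b /imsetP[y xy ->] /imsetP[z xz ->] yz] /=.
  by have := ef y xy; rewrite inE [f y \in N y]inE => /andP[].
have {}yz : y != z by apply: contra_neq yz => ->.
(* Disjoint arcs also need each tail to differ from the other head; heads lie in the second
   out-neighbourhood, which avoids [N x]. *)
have disj u v : u \in N x -> v \in N x -> u != f v.
  move=> xu /ef; rewrite !inE => /and3P[_ + _]; apply: contraNneq => <-.
  by move: xu; rewrite inE => ->.
have fyz : f y != f z by apply: contra_neq yz; apply: injf.
rewrite disjoints_subset subUset !sub1set !inE !negb_or yz fyz.
by rewrite disj // eq_sym disj.
Qed.

(* A pair in [S] carries at most one arc, and none if it lies in [P]. *)
Lemma arcs_bound (P S : {set T}) :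
  P \subset S -> {in P &, forall y z, ~~ D y z} ->
  (\sum_(y in S) #|N y :&: S|).*2 + #|P| * #|P|.-1 <= #|S| * #|S|.-1.
Proof.
move=> sPS indP.
have square (R : {set T}) : \sum_(y in R) \sum_(z in R) (y != z) = #|R| * #|R|.-1.
  rewrite -sum_nat_const; apply: eq_bigr => y Ry.
  rewrite (bigD1 y) //= eqxx add0n (cardsD1 y R) Ry -sum1_card.
  apply: eq_big => [z|z /andP[_]]; first by rewrite in_setD1 andbC.
  by rewrite eq_sym => ->.
have degE : \sum_(y in S) #|N y :&: S| = \sum_(y in S) \sum_(z in S) D y z.
  apply: eq_bigr => y _; rewrite -sum1_card big_mkcond [RHS]big_mkcond.
  by apply: eq_bigr => z _; rewrite !inE andbC; case: (z \in S) (D y z) => [] [].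
have PE : \sum_(y in P) \sum_(z in P) (y != z)
    = \sum_(y in S) \sum_(z in S) [&& y \in P, z \in P & y != z].
  rewrite [RHS](big_setID P) /= (setIidPr sPS) [X in _ + X]big1 ?addn0.
    apply: eq_bigr => y Py; rewrite [RHS](big_setID P) /= (setIidPr sPS).
    rewrite [X in _ + X]big1 ?addn0 => [|z].
      by apply: eq_bigr => z ->; rewrite Py.
    by rewrite inE => /andP[/negPf->]; rewrite andbF.
  by move=> y; rewrite inE => /andP[/negPf-> _]; rewrite big1.
(* Exchanging the sums in one of the two copies reduces the claim to a single ordered pair [(y, z)]:
   [D y z], [D z y] and a distinct pair in [P] exclude one another, and each forces [y != z]. *)
rewrite -!square PE -addnn degE [X in _ + X + _]exchange_big /= -!big_split /=.
apply: leq_sum => y Sy; rewrite -!big_split /=; apply: leq_sum => z Sz.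
have [->|yz] := eqVneq y z; first by rewrite arcxx !andbF.
have [/and3P[Py Pz _]|_] := boolP [&& y \in P, z \in P & true].
  by rewrite (negPf (indP _ _ Py Pz)) (negPf (indP _ _ Pz Py)).
by have := @arcC y z; case: (D y z) (D z y) => [] [] // /(_ isT).
Qed.

(** * Counting around vertices of minimum out-degree *)

Variable d : nat.
Hypothesis d_min : forall v, d <= #|N v|.
Hypothesis d_le4 : d <= 4.

(** Vertices of [R] have no arc to [w], so they need out-neighbours inside [R]. Having at most three
    vertices, [R] has few arcs; this forces [R = C] and [d = 4], and leaves no room for a missing
    arc to [N w :\: N y]. *)
Lemma source_of_obstruction y w S B :
  #|N y| = d -> w \in N y -> {in N y, forall c, ~~ D c w} ->
  obstruction y S B ->
  {in N y :\ w, forall c, N w :\: N y \subset N c}.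
Proof.
move=> dy yw srcw [sSy S0 ltBS NS].
pose C := N y :\ w; pose R := S :\ w.
have sRC : R \subset C by apply: setSD.
have cardC : #|C| = d.-1 by rewrite -dy (cardsD1 w (N y)) yw.
have cardCR : #|C| = #|R| + #|C :\: R|.
  by rewrite -(cardsID R C) (setIidPr sRC).
have S_gt0 : 0 < #|S| by rewrite card_gt0.
have cardS : #|S| = (w \in S) + #|R| by exact: cardsD1.
have deg c : c \in R -> d <= #|N c :&: R| + #|C :\: R| + #|N c :&: B|.
  rewrite inE => /andP[cw Sc]; apply: leq_trans (d_min c) _.
  have sub : N c \subset (N c :&: R) :|: (C :\: R) :|: (N c :&: B).
    apply/subsetP=> u cu; have := subsetP (NS c Sc) _ cu.
    have uw : u != w.
      apply: contraTneq cu => ->; rewrite inE; apply: srcw.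
      exact: (subsetP sSy).
    rewrite !in_setU !in_setI !in_setD !in_set1 cu uw /=.
    by case/orP=> ->; rewrite ?orbT //=; case: (u \in S).
  apply: leq_trans (subset_leq_card sub) _.
  apply: leq_trans (leq_card_setU _ _).1 _; rewrite leq_add2r.
  exact: (leq_card_setU _ _).1.
have degB c : #|N c :&: B| <= #|B| by apply/subset_leq_card/subsetIr.
have arcs : (\sum_(y in R) #|N y :&: R|).*2 <= #|R| * #|R|.-1.
  have := @arcs_bound set0 R (sub0set _).
  by rewrite cards0 addn0; apply=> u v; rewrite inE.
have arcsR k : (forall c, c \in R -> k <= #|N c :&: R|) ->
    #|R| = 0 \/ k.*2 < #|R|.
  move=> leR; have : (#|R| * k).*2 <= #|R| * #|R|.-1.
    apply: leq_trans arcs.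
    by rewrite leq_double -sum_nat_const; apply: leq_sum.
  rewrite doubleMr; case: #|R| => [|r]; first by left.
  by rewrite leq_pmul2l //; right.
have d_gt0 : 0 < d by rewrite -dy (cardsD1 w (N y)) yw.
(* Otherwise [#|B| < #|R|], each vertex of [R] has two out-neighbours in [R], and [#|R| > 4] while
   [#|C| <= 3]. *)
have Sw : w \in S.
  apply/negPn/negP=> Sw; rewrite (negPf Sw) /= in cardS.
  case: (arcsR 2) => [c Rc||]; [|lia|lia].
  by have := deg c Rc; have := degB c; lia.
rewrite Sw in cardS.
have R_gt0 : 0 < #|R|.
  rewrite lt0n; apply/negP=> /eqP R0.
  have B0 : B = set0 by apply/eqP; rewrite -cards_eq0; lia.
  have sub : N w \subset N y :\ w.
    by rewrite subsetD1 inE arcxx andbT -[N y]setU0 -B0 NS.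
  by have := subset_leq_card sub; have := d_min w; rewrite -/C; lia.
(* Now [#|B| <= #|R|] gives inner out-degrees at least 1, so [3 <= #|R| <= #|C| = d.-1 <= 3]. *)
have cardR : #|R| = 3 /\ #|C| = 3.
  case: (arcsR 1) => [c Rc||]; [|lia|lia].
  by have := deg c Rc; have := degB c; lia.
have [R3 C3] := cardR; have d4 : d = 4 by lia.
have leB3 : #|B| <= 3 by rewrite R3 in cardS; rewrite -ltnS -[4]cardS.
have deg4 c : c \in R -> 4 <= #|N c :&: R| + #|N c :&: B|.
  have CR0 : #|C :\: R| = 0 by apply/eqP; rewrite -(eqn_add2l #|R|) -cardCR R3 C3.
  by move/deg; rewrite d4 CR0 addn0.
move=> c Cc; apply/subsetP=> z; rewrite inE => /andP[yz wz].
have RC : R = C by apply/eqP; rewrite eqEcard sRC C3 R3.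
have Bz : z \in B.
  by have := subsetP (NS w Sw) _ wz; rewrite in_setU (negPf yz).
apply/negPn/negP=> cz.
have degB_c : #|N c :&: B| <= 2.
  have ltcB : N c :&: B \proper B.
    rewrite properE subsetIr; apply/subsetPn; exists z => //.
    by rewrite in_setI (negPf cz).
  by rewrite -ltnS (leq_trans (proper_card ltcB)).
have Rc : c \in R by rewrite RC.
have Rc2 : #|R :\ c| = 2.
  by have := cardsD1 c R; rewrite Rc R3 => -[].
(* Two arcs of [R] leave [c] and at least one leaves each other vertex: four arcs on three
   vertices. *)
have: 4.*2 <= 3 * 3.-1; last by [].
rewrite R3 in arcs; apply: leq_trans arcs.
rewrite leq_double (bigD1 c) //= -[4]/(2 + 2) -[X in _ + X <= _]Rc2 -sum1_card.
apply: leq_add.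
  by rewrite -(leq_add2r 2) (leq_trans (deg4 c Rc)) // leq_add2l.
under eq_bigl => v do rewrite in_setD1 andbC.
apply: leq_sum => v /andP[Rv _]; rewrite -(leq_add2r 3).
by rewrite (leq_trans (deg4 v Rv)) // leq_add2l (leq_trans (degB v)).
Qed.

Lemma obstruction_out_nbr x S B :
  #|N x| = d -> obstruction x S B ->
  exists2 y, #|N y| = d & forall S' B', ~ obstruction y S' B'.
Proof.
move=> dx [sSx S0 ltBS NS].
pose C := (N x :\: S) :|: B.
have S_gt0 : 0 < #|S| by rewrite card_gt0.
have cardNx : #|N x :\: S| = d - #|S| by rewrite cardsD (setIidPr sSx) dx.
have leSd : #|S| <= d by rewrite -dx subset_leq_card.
have leC : #|C| <= d.-1.
  by apply: leq_trans (leq_card_setU _ _).1 _; rewrite cardNx; lia.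
have NC y : y \in S -> N y \subset (N y :&: S) :|: C.
  move=> Sy; apply/subsetP=> u yu; have := subsetP (NS y Sy) _ yu.
  rewrite !in_setU in_setI in_setD yu.
  by case: (u \in S) => //= /orP[] ->; rewrite ?orbT.
have leNC y : y \in S -> d <= #|N y :&: S| + #|C|.
  move=> Sy; apply: leq_trans (d_min y) _.
  exact: leq_trans (subset_leq_card (NC y Sy)) (leq_card_setU _ _).1.
pose P := [set y in S | #|N y :&: S| == 1].
have sPS : P \subset S by apply/subsetP=> y; rewrite inE => /andP[].
(* Equality holds throughout [d <= #|N y| <= 1 + #|N y :&: C| <= 1 + #|C| <= d]. *)
have domC y : y \in P -> C \subset N y /\ #|N y| = d.
  rewrite inE => /andP[Sy /eqP deg1].
  have sub : N y \subset (N y :&: S) :|: (N y :&: C).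
    rewrite -setIUr subsetI subxx /=.
    by apply: subset_trans (NC y Sy) (setSU _ _); apply: subsetIr.
  have := leq_trans (subset_leq_card sub) (leq_card_setU _ _).1.
  have := subset_leq_card (subsetIr (N y) C); have := d_min y.
  rewrite deg1 => dy leNyC leNy; split; last by lia.
  by apply/setIidPr/eqP; rewrite eqEcard subsetIr; lia.
have [y [w [Py Pw yw]]] : exists y w, [/\ y \in P, w \in P & D y w].
  have [/existsP[y /andP[Py /existsP[w /andP[Pw yw]]]]|/existsPn indep] :=
      boolP [exists y, (y \in P) && [exists w, (w \in P) && D y w]].
    by exists y, w.
  have indP : {in P &, forall y w, ~~ D y w}.
    move=> y w Py Pw; have := indep y; rewrite Py => /existsPn/(_ w).
    by rewrite Pw.
  have arcs := arcs_bound sPS indP.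
  have : #|P| + 2 * #|S :\: P| <= \sum_(y in S) #|N y :&: S|.
    rewrite (big_setID P) /= (setIidPr sPS) -sum1_card mulnC -sum_nat_const.
    apply: leq_add; apply: leq_sum => y.
      by rewrite inE => /andP[_ /eqP->].
    rewrite !inE => /andP[+ Sy]; rewrite Sy /=.
    by have := leNC y Sy; move: leC leSd S_gt0; clear; lia.
  have := cardsID P S; rewrite (setIidPr sPS).
  (* With [p = #|P|] and [s = #|S|], the two bounds give [s * (5 - s) <= p * (3 - p)]; for
     [1 <= s <= 4] the left side is at least 4 and the right side at most 2. *)
  move: #|P| #|S :\: P| #|S| (\sum_(y in S) _) S_gt0 (leq_trans leSd d_le4) arcs.
  clear=> p q [|[|[|[|[|s]]]]] // t _ _; case: p => [|[|[|[|[|p]]]]] /=; lia.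
have [[sCy dy] [sCw _]] := (domC y Py, domC w Pw).
have [Sy Sw] := (subsetP sPS _ Py, subsetP sPS _ Pw).
have NyS : N y :&: S = [set w].
  apply/eqP; rewrite eq_sym eqEcard sub1set cards1 in_setI inE yw Sw /=.
  by move: Py; rewrite inE => /andP[_ /eqP->].
exists y => // S' B' obs.
(* [w] is a source of [N y] because it dominates [C], which contains [N y :\ w]. *)
have domz : {in N y :\ w, forall c, N w :\: N y \subset N c}.
  apply: source_of_obstruction dy _ _ obs => [|c yc]; first by rewrite inE.
  have := subsetP (NC y Sy) _ yc; rewrite NyS in_setU in_set1.
  case/orP=> [/eqP->|Cc]; first by rewrite arcxx.
  by apply: arcC; have := subsetP sCw _ Cc; rewrite inE.
have [z wz yz] : exists2 z, z \in N w & z \notin N y.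
  apply/subsetPn/negP=> sub.
  have := subset_leq_card (_ : N w \subset N y :\ w).
  rewrite subsetD1 sub inE arcxx => /(_ isT).
  move/(leq_trans (d_min w)).
  by rewrite -dy (cardsD1 w (N y)) inE yw ltnn.
(* All of [C] dominates [z], and 2-cycles are excluded. *)
have zNC c : D z c -> c \notin C.
  move=> zc; apply/negP=> Cc.
  have cw : c != w.
    by apply: contraTneq zc => ->; apply: arcC; rewrite inE in wz.
  have Nc : c \in N y :\ w by rewrite in_setD1 cw (subsetP sCy).
  have := subsetP (domz c Nc) z; rewrite inE yz wz => /(_ isT).
  by rewrite inE => /arcC; rewrite zc.
have Sz : z \in S.
  have := subsetP (NC w Sw) _ wz; rewrite in_setU in_setI.
  by case/orP=> [/andP[]//|/(subsetP sCy)]; rewrite (negPf yz).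
have sub : N z \subset S :\ z.
  apply/subsetP=> c zc; have := subsetP (NC z Sz) _ zc.
  rewrite inE in zc; rewrite in_setU (negPf (zNC c zc)) orbF in_setI in_setD1.
  by case/andP=> _ ->; rewrite andbT; apply: contraTneq zc => ->; rewrite arcxx.
have := leq_trans leSd (leq_trans (d_min z) (subset_leq_card sub)).
by rewrite (cardsD1 z S) Sz ltnn.
Qed.

Lemma min_out_degree_le v : min_out_degree D <= out_degree D v.
Proof.
rewrite /min_out_degree; have: v \in index_enum T by apply: mem_index_enum.
elim: (index_enum T) => // u s IHs; rewrite in_cons big_cons => /predU1P[->|/IHs].
  exact: geq_minl.
exact: leq_trans (geq_minr _ _).
Qed.

Lemma min_out_degree_attained :
  0 < #|T| -> exists v, out_degree D v = min_out_degree D.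
Proof.
case/card_gt0P=> v0 _; case: (@arg_minnP _ v0 predT (out_degree D)) => // v _ vmin.
exists v; apply/eqP; rewrite eqn_leq min_out_degree_le andbT.
(* The initial value [#|T|] of the minimum is harmless, since no out-degree exceeds it. *)
apply: (big_ind (leq (out_degree D v))) => [|a b va vb|u _]; first exact: max_card.
  by rewrite leq_min va.
exact: vmin.
Qed.

End Oriented.

Theorem theorem1p4 (T : finType) (D : rel T)
    (T_nonempty : 0 < #|T|)
    (D_oriented : oriented_graph D)
    (D_mindeg : min_out_degree D <= 4) :
  exists x : T,
    out_degree D x = min_out_degree D /\ strong_seymour_vertex D x.
Proof.
have [x dx] := min_out_degree_attained D T_nonempty.
have [Sx|[S [B obs]]] := strong_seymour_or_obstruction D_oriented x.
  by exists x.
have [y dy no_obs] :=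
  obstruction_out_nbr D_oriented (min_out_degree_le D) D_mindeg dx obs.
exists y; split=> //.
by have [//|[S' [B' /no_obs]]] := strong_seymour_or_obstruction D_oriented y.
Qed.
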